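(* Let $\mathcal H$ be an infinite dimensional separable complex Hilbert space and let $T$ be a diskcyclic bounded linear operator on $\mathcal H$. Then: (1) for every diskcyclic vector $x$ of $T$, the set $\{\alpha\langle T^n x,x\rangle : \alpha\in\mathbb C,\ |\alpha|\le 1,\ n\ge 0\}$ is dense in $\mathbb C$; (2) the set $\mathbb D\bigcup_{n=0}^{\infty}\omega(T^n)=\{\alpha w : \alpha\in\mathbb C,\ |\alpha|\le 1,\ w\in\bigcup_{n\ge 0}\omega(T^n)\}$ is dense in $\mathbb C$.
   Context: $\mathbb D=\{z\in\mathbb C: |z|\le 1\}$ is the closed unit disk. A vector $x\in\mathcal H$ is diskcyclic for a bounded linear operator $T$ on $\mathcal H$ if $\{\alpha T^n x : n\ge 0,\ \alpha\in\mathbb C,\ |\alpha|\le 1\}$ is dense in $\mathcal H$; $T$ is diskcyclic if it has a diskcyclic vector. The numerical range of $T$ is $\omega(T)=\{\langle Tx,x\rangle : \|x\|=1\}$. *)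

(* Defs.v *)
From HB Require Import structures.
From mathcomp Require Import all_boot all_order all_algebra.
From mathcomp Require Import all_classical all_reals all_analysis.
From mathcomp Require Import complex.

Set Implicit Arguments.
Unset Strict Implicit.
Unset Printing Implicit Defensive.

Import Order.TTheory GRing.Theory Num.Theory.
Import numFieldNormedType.Exports.

Local Open Scope classical_set_scope.
Local Open Scope complex_scope.
Local Open Scope ring_scope.

Definition separable_space (X : topologicalType) : Prop :=
  exists2 D : set X, countable D & dense D.

Definition finite_dimensional (K : numFieldType) (V : lmodType K) : Prop :=
  exists (n : nat) (e : 'I_n -> V),
    forall v : V, exists c : 'I_n -> K, v = \sum_(i < n) c i *: e i.

Section ComplexHilbert.
Variables (R : realType) (H : normedModType R[i]).

(* A complex Hilbert space is a complete H together with such a form. The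
   forms of type {dot _ for _} are positive definite, linear in the first
   argument and conjugate-linear in the second. *)
Definition induces_norm (dot : {dot H for @Num.conj R[i]}) : Prop :=
  forall x : H, `|x| ^+ 2 = dot x x.

Definition bounded_operator (T : H -> H) : Prop :=
  exists M : R, forall x : H, `|T x| <= M%:C * `|x|.

(* The topology of the complex plane is carried by R[i]^o (R[i] seen as a
   normed module over itself), not by the bare type R[i]. *)
Definition closed_unit_disk : set R[i]^o := [set z | `|z| <= 1].

Definition disk_orbit (T : H -> H) (x : H) : set H :=
  [set y | exists (n : nat) (a : R[i]^o),
     closed_unit_disk a /\ y = a *: iter n T x].

Definition diskcyclic_vector (T : H -> H) (x : H) : Prop :=
  dense (disk_orbit T x).

Definition diskcyclic (T : H -> H) : Prop :=
  exists x : H, diskcyclic_vector T x.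

Definition numerical_range (dot : {dot H for @Num.conj R[i]}) (T : H -> H) :
    set R[i]^o :=
  [set w | exists2 x : H, `|x| = 1 & w = dot (T x) x].

End ComplexHilbert.

Arguments closed_unit_disk : clear implicits.

(* Main.v *)
Require Import Defs.
From HB Require Import structures.
From mathcomp Require Import all_boot all_order all_algebra.
From mathcomp Require Import all_classical all_reals all_analysis.
From mathcomp Require Import complex.
From mathcomp Require Import ring.

Import Order.TTheory GRing.Theory Num.Theory.
Import numFieldNormedType.Exports.

Local Open Scope classical_set_scope.
Local Open Scope complex_scope.
Local Open Scope ring_scope.

(* If y |-> f y is a continuous map onto C, it sends the dense disk orbit of x
   to a dense set.  Both claims are this remark for f y = <y, x> and for
   f y = <y, x> / |x|^2: the latter sends T^n x to <T^n u, u>, where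
   u = x / |x|. *)

Lemma dense_image (X Y : topologicalType) (f : X -> Y) (D : set X) :
  continuous f -> (forall y, exists x, f x = y) -> dense D -> dense (f @` D).
Proof.
move=> cf f_onto dD O [y Oy] oO.
have [x fxy] := f_onto y.
have [z [Oz Dz]] := dD (f @^-1` O) (ex_intro _ x (eq_ind_r O Oy fxy))
  (open_comp (fun z _ => cf z) oO).
by exists (f z); split=> //; exists z.
Qed.

(* MathComp's [CauchySchwarz] is restricted to finite-dimensional spaces. *)
Lemma dot_CauchySchwarz (C : numClosedFieldType) (U : lmodType C)
    (dot : {dot U for @Num.conj C}) (u v : U) :
  `|dot u v| ^+ 2 <= dot u u * dot v v.
Proof.
have [->|v0] := eqVneq v 0; first by rewrite !linear0r normr0 expr0n.
have dv_gt0 : 0 < dot v v by rewrite dnorm_gt0.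
have dv_conj : ((dot v v)^-1)^* = (dot v v)^-1.
  by rewrite geC0_conj ?invr_ge0 ?dnorm_ge0.
(* The vector is [u] minus its orthogonal projection onto [v]; expanding its nonnegative square
   gives the inequality after multiplication by [dot v v]. *)
have := @dnorm_ge0 _ _ dot (u - (dot u v / dot v v) *: v).
rewrite dnormB dnormZ !linearZr_LR /= !rmorphM /= !dv_conj conjCK.
rewrite normrM normfV (gtr0_norm dv_gt0).
suff -> : dot u u + (`|dot u v| / dot v v) ^+ 2 * dot v v
    - ((dot u v)^* / dot v v * dot u v + dot u v / dot v v * (dot u v)^*)
    = dot u u - `|dot u v| ^+ 2 / dot v v.
  by rewrite subr_ge0 ler_pdivrMr.
by rewrite expr_div_n normCK; field; rewrite lt0r_neq0.
Qed.

Lemma iterZ (K : pzRingType) (V : lmodType K) (T : {linear V -> V}) n a v :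
  iter n T (a *: v) = a *: iter n T v.
Proof. by elim: n => //= n ->; rewrite linearZ. Qed.

Section Diskcyclic.
Context {R : realType} {H : normedModType R[i]}.
Implicit Types (dot : {dot H for @Num.conj R[i]}) (x : H).

Lemma dot_le_norm dot x y : induces_norm dot -> `|dot x y| <= `|x| * `|y|.
Proof.
move=> dot_norm; rewrite -ler_sqr ?nnegrE ?mulr_ge0 // exprMn !dot_norm.
exact: dot_CauchySchwarz.
Qed.

Lemma dotl_continuous dot x : induces_norm dot ->
  continuous (fun y : H => dot y x : R[i]^o).
Proof.
move=> dot_norm y; apply/cvgrPdist_lt => e e0.
(* Adding 1 keeps the divisor of [e] positive even when [x] is 0. *)
have x1_gt0 : 0 < `|x| + 1 by rewrite ltr_wpDl.
near=> z.
have -> : dot y x - dot z x = dot (y - z) x by rewrite linearBl.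
apply: (le_lt_trans (dot_le_norm _ _ _ dot_norm)).
have /le_lt_trans : `|y - z| * `|x| <= `|y - z| * (`|x| + 1).
  by rewrite ler_wpM2l // lerDl.
apply; rewrite -ltr_pdivlMr //.
by near: z; apply: cvgr_dist_lt; rewrite // divr_gt0.
Unshelve. all: by end_near. Qed.

(** The disk orbit of 0 is [{0}], which is dense only in the zero space, and that space is spanned
    by the empty family. *)
Lemma diskcyclic_vector_neq0 (T : {linear H -> H}) x :
  ~ finite_dimensional H -> diskcyclic_vector T x -> x != 0.
Proof.
move=> H_infdim x_cyc; apply/eqP => x0; apply: H_infdim.
exists 0, (fun=> 0) => v; exists (fun=> 0); rewrite big_ord0.
apply: contrapT => v0.
(* If [v] were nonzero, this open set would be nonempty and so would meet the disk orbit of 0. *)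
have o0 : open (~` [set (0 : H)]).
  by rewrite openC; exact/accessible_closed_set1/hausdorff_accessible/norm_hausdorff.
have [y [y0 [n [a [_ yE]]]]] := x_cyc _ (ex_intro _ v v0) o0.
apply: y0; rewrite /= yE x0.
by have := iterZ _ _ T n 0 0; rewrite !scale0r => ->; rewrite scaler0.
Qed.

(** The factor [c] lets one statement serve both claims: [c = 1] for the first, the inverse square
    of the norm of [x] for the second. *)
Lemma dense_dot_disk_orbit dot (T : H -> H) x (c : R[i]) :
  induces_norm dot -> x != 0 -> c != 0 -> diskcyclic_vector T x ->
  dense ((fun y => c * dot y x : R[i]^o) @` disk_orbit T x).
Proof.
move=> dot_norm x0 c0; apply: dense_image.
  move=> y; apply: (@cvgM R[i]); first exact: cvg_cst.
  exact: dotl_continuous.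
(* Multiples of [x] already reach every [z], because [c * dot x x] is nonzero. *)
move=> z; exists ((z / (c * dot x x)) *: x).
rewrite linearZl_LR /= mulrCA divfK //.
by rewrite mulf_neq0 // dnorm_eq0.
Qed.

End Diskcyclic.

Theorem theorem2p2 (R : realType) (H : completeNormedModType R[i])
    (dot : {dot H for @Num.conj R[i]}) (dot_norm : induces_norm dot)
    (H_infdim : ~ finite_dimensional H) (H_sep : separable_space H)
    (T : {linear H -> H}) (T_bounded : bounded_operator T)
    (T_diskcyclic : diskcyclic T) :
  (forall x : H, diskcyclic_vector T x ->
     dense [set z : R[i]^o | exists (a : R[i]^o) (n : nat),
              closed_unit_disk R a /\ z = a * dot (iter n T x) x]) /\
  dense [set z : R[i]^o | exists a w : R[i]^o,
           [/\ closed_unit_disk R a,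
               (\bigcup_(n : nat) numerical_range dot (iter n T)) w
             & z = a * w]].
Proof.
have neq0 x := @diskcyclic_vector_neq0 _ _ T x H_infdim.
split=> [x x_cyc|].
  have := dense_dot_disk_orbit dot T x 1 dot_norm (neq0 x x_cyc) (oner_neq0 _) x_cyc.
  move=> dD O O0 oO; have [z [Oz [_ [n [a [a1 ->]]] zE]]] := dD O O0 oO.
  exists (a * dot (iter n T x) x); split; last by exists a, n.
  by move: Oz; rewrite -zE linearZl_LR /= mul1r.
have [x x_cyc] := T_diskcyclic.
have nx0 : `|x| != 0 by rewrite normr_eq0 neq0.
have c0 : (`|x| ^+ 2)^-1 != 0 by rewrite invr_eq0 expf_neq0.
have dD := dense_dot_disk_orbit dot T x _ dot_norm (neq0 x x_cyc) c0 x_cyc.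
move=> O O0 oO; have [z [Oz [_ [n [a [a1 ->]]] zE]]] := dD O O0 oO.
(* The unit vector [u] realizes the factor [c] as a normalization, so the same scalar [a] works. *)
pose u := `|x|^-1 *: x.
exists z; split=> //; exists a, (dot (iter n T u) u); split=> //.
  exists n => //; exists u => //.
  by rewrite normrZ normfV normr_id mulVf.
(* Each argument of the form contributes one inverse norm; the one from the conjugate-linear
   argument is real, hence unchanged by conjugation. *)
have uE : dot (iter n T u) u = `|x| ^- 2 * dot (iter n T x) x.
  rewrite iterZ linearZl_LR linearZr_LR /= geC0_conj ?invr_ge0 //.
  by rewrite mulrA -expr2 exprVn.
by rewrite -zE uE linearZl_LR /= mulrCA.
Qed.
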